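(* Let $d\ge 3$ and let $\eta$ be an $\mathbb{N}$-valued random variable with $\mathbf{P}[\eta\ge1]>0$. Suppose that $\mathbf{E}\,\eta^\varepsilon<\infty$ for every $0<\varepsilon<1$. Then $p_u(\mathbb{T}_d,\eta)=1$.
   Context: Here $\mathbb{N}=\{0,1,2,\dots\}$, and $\mathbb{T}_d$ denotes the infinite homogeneous tree in which every vertex has degree $d$, with a fixed root $\mathbf{0}$. Frog model $\mathrm{FM}(\mathcal{G},p,\eta)$. Let $\mathcal{G}$ be an infinite connected undirected graph all of whose sites (vertices) have finite degree, with a fixed site $\mathbf{0}$ called the root; let $p\in[0,1]$ and let $\eta$ be a random variable with values in $\mathbb{N}$. Let $\{\eta(x)\}_{x}$, $\{(S^x_n(i))_{n\in\mathbb{N}}\}_{x,\,i\ge1}$, $\{\Xi^x_p(i)\}_{x,\,i\ge 1}$ be independent families of independent random variables, where $\eta(x)$ has the law of $\eta$, $(S^x_n(i))_n$ is a discrete-time simple random walk on $\mathcal{G}$ started from $x$, and $\mathbf{P}[\Xi^x_p(i)=k]=(1-p)p^{k-1}$, $k=1,2,\dots$ (for $p=1$, $\Xi^x_p(i)=\infty$, no death). Site $x$ initially contains $\eta(x)$ particles; at time $0$ all particles are sleeping except those at the root, which are active. If the particles of site $x$ are activated at time $T(x)$, the $i$-th of them ($1\le i\le\eta(x)$) is active and located at $S^x_n(i)$ at time $T(x)+n$ for $0\le n<\Xi^x_p(i)$, and then disappears. When an active particle visits a site, all sleeping particles there become active. Formally, $t(x,y)=\min_{1\le i\le\eta(x)}\min\{n<\Xi^x_p(i):S^x_n(i)=y\}$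 for $x\ne y$ ($\infty$ if there is no such $n$), and $T(x)=\inf\{t(x_0,x_1)+\dots+t(x_{m-1},x_m)\}$ over all finite sequences $\mathbf{0}=x_0,x_1,\dots,x_m=x$, with $T(\mathbf{0})=0$; $T(x)=\infty$ means that $x$ is never visited by active particles. The root is hit infinitely often if there are infinitely many times at which some active particle is located at $\mathbf{0}$. Define $p_u(\mathcal{G},\eta)=\inf\{p\in[0,1]:\mathbf{P}[\mathbf{0}\text{ is hit infinitely often in }\mathrm{FM}(\mathcal{G},p,\eta)]>0\}$, with the convention $\inf\emptyset=1$. *)

(* Defs.v *)
From HB Require Import structures.
From mathcomp Require Import all_boot all_order all_algebra.
From mathcomp Require Import all_classical all_reals all_analysis.

Set Implicit Arguments.
Unset Strict Implicit.
Unset Printing Implicit Defensive.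

Import Order.TTheory GRing.Theory Num.Theory.

Local Open Scope classical_set_scope.
Local Open Scope ring_scope.

(* Local finiteness is built in through adjacency lists.  Taking the vertex
   type countable loses no generality: a connected locally finite graph is
   countable. *)
Record rooted_graph := RootedGraph {
  vertex :> countType;
  origin : vertex;
  nbrs : vertex -> seq vertex;
  nbrs_uniq : forall x, uniq (nbrs x);
  nbrs_sym : symmetric (grel nbrs);
  nbrs_irr : irreflexive (grel nbrs);
  graph_connected : forall x y : vertex,
    exists2 s : seq vertex, path (grel nbrs) x s & y = last x s;
  graph_infinite : infinite_set [set: vertex]
}.

Definition degree (G : rooted_graph) (x : G) : nat := size (nbrs x).

(* Connectedness and infiniteness are part of [rooted_graph]. *)
Definition homogeneous_tree (d : nat) (G : rooted_graph) : Prop :=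
  (forall x : G, degree x = d) /\
  (forall s : seq G, (2 < size s)%N -> ~ ucycle (grel (@nbrs G)) s).

Definition srw_step (R : realType) (G : rooted_graph) (x y : G) : R :=
  (y \in nbrs x)%:R / (degree x)%:R.

Definition discrete_rv (d : measure_display) (T : measurableType d) (A : Type)
    (X : T -> A) : Prop :=
  forall B : set A, measurable (X @^-1` B).

Definition sigma_rv (T A : Type) (X : T -> A) : set_system T :=
  [set X @^-1` B | B in [set: set A]].

Definition sigma_process (T A : Type) (X : nat -> T -> A) : set_system T :=
  <<s \bigcup_n sigma_rv (X n) >>.

Definition mutually_independent (d : measure_display) (T : measurableType d)
    (R : realType) (P : probability T R) (I : choiceType)
    (F : I -> set_system T) : Prop :=
  forall (s : seq I) (A : I -> set T), uniq s ->
    (forall i, i \in s -> F i (A i)) ->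
    P (\big[setI/setT]_(i <- s) A i) = (\prod_(i <- s) P (A i))%E.

(* The frog model FM(G, p, eta), where [mu] is the law of eta, on an arbitrary
   probability space carrying it.  [sleepers x] is the number of particles at [x];
   the particles of [x] are those of index [i < sleepers x w] (numbered from 0);
   [walk x i n] is the position of the i-th one n steps after its activation;
   [life x i] is its lifetime, [None] being an infinite one. *)
Record frog_model (R : realType) (G : rooted_graph) (p : R)
    (mu : probability nat R) := FrogModel {
  fm_disp : measure_display;
  fm_space : measurableType fm_disp;
  fm_prob : probability fm_space R;
  sleepers : G -> fm_space -> nat;
  walk : G -> nat -> nat -> fm_space -> G;
  life : G -> nat -> fm_space -> option nat;
  sleepers_rv : forall x, discrete_rv (sleepers x);
  walk_rv : forall x i n, discrete_rv (walk x i n);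
  life_rv : forall x i, discrete_rv (life x i);
  sleepers_law : forall x (B : set nat), fm_prob (sleepers x @^-1` B) = mu B;
  walk_law : forall x i n (y : nat -> G),
    fm_prob [set w | forall k, (k <= n)%N -> walk x i k w = y k] =
    ((y 0%N == x)%:R * \prod_(k < n) srw_step R (y k) (y k.+1))%:E;
  life_law : forall x i k,
    fm_prob (life x i @^-1` [set Some k.+1]) = ((1 - p) * p ^+ k)%:E;
  life_law1 : p = 1 -> forall x i, fm_prob (life x i @^-1` [set None]) = 1%E;
  fm_indep : mutually_independent fm_prob
    (fun j : G + G * nat + G * nat =>
       match j with
       | inl (inl x) => sigma_rv (sleepers x)
       | inl (inr (x, i)) => sigma_process (walk x i)
       | inr (x, i) => sigma_rv (life x i)
       end)
}.

Section FrogModel.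
Context {R : realType} {G : rooted_graph} {p : R} {mu : probability nat R}.
Variable M : frog_model G p mu.
Implicit Types (x y : G) (i n : nat) (w : fm_space M).

Definition alive x i n w : bool :=
  if life x i w is Some k then (n < k)%N else true.

Definition occupies x i n w y : Prop :=
  [/\ (i < sleepers x w)%N, alive x i n w & walk x i n w = y].

Definition crossing_time x y w : \bar R :=
  ereal_inf [set n%:R%:E | n in [set n | exists i, occupies x i n w y]].

(* Consecutive vertices of the sequence [origin :: s] are allowed to coincide;
   this does not change the infimum, since crossing times are nonnegative. *)
Definition activation_time x w : \bar R :=
  ereal_inf [set (\sum_(e <- zip (origin G :: s) s) crossing_time e.1 e.2 w)%E |
             s in [set s : seq G | last (origin G) s = x]].

Definition root_hit_at (m : nat) w : Prop :=
  exists x i n, occupies x i n w (origin G) /\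
    (activation_time x w + n%:R%:E = m%:R%:E)%E.

Definition root_hit_io : set (fm_space M) :=
  [set w | infinite_set [set m : nat | root_hit_at m w]].

End FrogModel.

Arguments root_hit_io {R G p mu} M.

(* The probability of [root_hit_io] is determined by (G, p, mu), so it does not
   matter which realization of the model is used. *)
Definition recurrent_params (R : realType) (G : rooted_graph)
    (mu : probability nat R) : set R :=
  [set p : R | 0 <= p <= 1 /\
     exists M : frog_model G p mu, (0 < fm_prob M (root_hit_io M))%E].

Definition p_u (R : realType) (G : rooted_graph) (mu : probability nat R) : R :=
  if `[< recurrent_params G mu !=set0 >] then inf (recurrent_params G mu)
  else 1.

(* Main.v *)
Require Import Defs.
From HB Require Import structures.
From mathcomp Require Import all_boot all_order all_algebra.
From mathcomp Require Import all_classical all_reals all_analysis.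
From mathcomp Require Import measurable_realfun ring lra.

(** Acyclicity of the tree plays no role: the argument works on every d-regular
    graph.  A visit to the root n steps after activation is made by a particle
    that, while alive, traverses one of the d^n walks of length n ending at the
    root.  As min(1, z) <= z^eps, a given such walk is traversed by one of the
    particles of its starting point with probability at most
    E[eta^eps] (p/d)^(n eps), so that some walk of length n is traversed with
    probability at most E[eta^eps] (d (p/d)^eps)^n.  For p < 1 and eps close
    to 1 this is summable, and by Borel-Cantelli only finitely many walks are
    ever traversed.  The time of a visit is determined by the length and the
    starting point of the walk, so the root is hit finitely often. *)

Set Implicit Arguments.
Unset Strict Implicit.
Unset Printing Implicit Defensive.

Import Order.TTheory GRing.Theory Num.Theory.

Local Open Scope classical_set_scope.
Local Open Scope ring_scope.

(** * Countable operations on events, and auxiliary inequalities *)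

Lemma measurable_exists d (T : measurableType d) (I : countType)
    (Q : I -> T -> Prop) :
  (forall i, measurable [set w | Q i w]) -> measurable [set w | exists i, Q i w].
Proof.
move=> mQ; rewrite (_ : [set _ | _] = \bigcup_i [set w | Q i w]).
  by apply: countable_bigcupT_measurable => //; exact: countableP.
by apply/seteqP; split => w /= [i]; [exists i|move=> _ Qi; exists i].
Qed.

Lemma measurable_forall d (T : measurableType d) (I : countType)
    (Q : I -> T -> Prop) :
  (forall i, measurable [set w | Q i w]) -> measurable [set w | forall i, Q i w].
Proof.
move=> mQ; rewrite (_ : [set _ | _] = ~` [set w | exists i, ~ Q i w]).
  by apply/measurableC/measurable_exists => i; exact: (measurableC (mQ i)).
apply/seteqP; split => w /=; first by move=> h [i]; apply.
by move=> h i; apply: contrapT => nQ; apply: h; exists i.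
Qed.

Lemma negligible_exists d (T : measurableType d) (R : realType)
    (mu : measure T R) (I : countType) (Q : I -> T -> Prop) :
  (forall i, mu.-negligible [set w | Q i w]) ->
  mu.-negligible [set w | exists i, Q i w].
Proof.
move=> nQ; pose F n := if unpickle n is Some i then [set w | Q i w] else set0.
apply: (@negligibleS _ _ _ _ (\bigcup_n F n)).
  by move=> w /= [i Qi]; exists (pickle i); rewrite // /F pickleK.
apply: negligible_bigcup => n; rewrite /F; case: unpickle => //.
exact: negligible_set0.
Qed.

Lemma measurable_ereal_inf (R : realType) d (T : measurableType d)
    (I : countType) (D : set I) (f : I -> T -> \bar R) :
  (forall i, measurable_fun setT (f i)) ->
  measurable_fun setT (fun w => ereal_inf [set f i w | i in D]).
Proof.
move=> mf.
(* Indices outside [D] and numbers that code no index get the value +oo, which leaves the infimum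
   unchanged. *)
pose g n w := if unpickle n is Some i then if `[< D i >] then f i w else +oo%E
              else +oo%E.
have mg n : measurable_fun setT (g n).
  rewrite /g; case: unpickle => [i|]; last exact: measurable_cst.
  by case: asboolP => _; [exact: mf|exact: measurable_cst].
apply: (eq_measurable_fun (fun w => einfs (g^~ w) 0)); last first.
  exact: measurable_fun_einfs.
move=> w _; apply/eqP; rewrite /einfs /sdrop eq_le.
apply/andP; split; apply: le_ereal_inf_tmp.
  move=> _ /= [i Di <-]; apply: ereal_inf_lbound; exists (pickle i) => //=.
  by rewrite /g pickleK asboolT.
move=> _ /= [n _ <-]; rewrite /g.
case: unpickle => [i|]; last exact: leey.
case: asboolP => [Di|_]; last exact: leey.
by apply: ereal_inf_lbound; exists i.
Qed.

Lemma infinite_natP (A : set nat) :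
  infinite_set A <-> forall n, exists2 m, (n <= m)%N & A m.
Proof.
split=> [infA n|uA].
  apply: contrapT => h; apply: infA.
  apply: (@sub_finite_set _ _ `I_n); last exact: finite_II.
  move=> m Am /=; rewrite ltnNge; apply/negP => nm; apply: h; by exists m.
move=> /finite_seqP[s As].
have [m mb Am] := uA (\max_(i <- s) i).+1.
move: Am; rewrite As /= => ms.
have := leq_trans mb (@leq_bigmax_seq _ s xpredT (fun i : nat => i) m ms isT).
by rewrite ltnn.
Qed.

(** For z >= 1 compare the exponents 0 and eps, for 0 < z <= 1 the exponents 1 and eps. This
    interpolation between the trivial bound and the union bound lets moments of order below 1
    suffice. *)
Lemma min_le_powR (R : realType) (z eps : R) : 0 <= z -> 0 < eps <= 1 ->
  Num.min 1 z <= z `^ eps.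
Proof.
move=> z0 /andP[e0 e1]; have [z1|/ltW z1] := leP 1 z.
  by rewrite -[leLHS](powRr0 z) ler_powR// ltW.
have [->|zN0] := eqVneq z 0; first exact: powR_ge0.
by rewrite -[leLHS]powRr1// ger_powR// z1 andbT lt0r zN0.
Qed.

Lemma measure_exists_le d (T : measurableType d) (R : realType)
    (mu : measure T R) (I : eqType) (L : seq I) (Q : I -> T -> Prop) (c : \bar R) :
  (forall i, measurable [set w | Q i w]) ->
  (forall i, (mu [set w | Q i w] <= c)%E) ->
  (mu [set w | exists2 i, i \in L & Q i w] <= (size L)%:R%:E * c)%E.
Proof.
move=> mQ muQ.
have consE j (s : seq I) : [set w | exists2 i, i \in j :: s & Q i w] =
    [set w | Q j w] `|` [set w | exists2 i, i \in s & Q i w].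
  apply/seteqP; split => w /=.
    by move=> [i]; rewrite inE => /orP[/eqP ->|is_ Qi]; [left|right; exists i].
  move=> [Qj|[i is_ Qi]]; first by exists j; rewrite ?mem_head.
  by exists i; rewrite // inE is_ orbT.
have mL (s : seq I) : measurable [set w | exists2 i, i \in s & Q i w].
  elim: s => [|j s IH].
    by rewrite (_ : mkset _ = set0)//; apply/seteqP; split => w //= [].
  by rewrite consE; exact: measurableU.
elim: L => [|j s IH].
  rewrite (_ : mkset _ = set0) ?measure0 ?mul0e//.
  by apply/seteqP; split => w //= [].
rewrite consE; apply: le_trans (measureU2 _ _ _) _ => //.
have c0 : (0 <= c)%E by apply: le_trans (muQ j).
rewrite /= -natr1 EFinD ge0_muleDl// mul1e addeC.
exact: leeD.
Qed.

Lemma geometric_nneseries_lty (R : realType) (r : R) : 0 < r < 1 ->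
  (\sum_(0 <= n <oo) (r ^+ n)%:E < +oo)%E.
Proof.
move=> /andP[r0 r1].
apply: le_lt_trans (ltry (1 / (1 - r))).
apply: lime_le.
  by apply: is_cvg_nneseries => n _ _; rewrite lee_fin exprn_ge0// ltW.
near=> n; rewrite sumEFin lee_fin.
have := @geometric_le_lim R n 1 r ler01 r0; rewrite gtr0_norm// => /(_ r1).
by rewrite /series /=; under eq_bigr do rewrite mul1r.
Unshelve. all: by end_near. Qed.

(** Splitting the space by the value of [X] turns the moment hypothesis into a series in the law of
    [eta], which is all that a frog model retains of [eta]. *)
Lemma moment_nneseries d (T : measurableType d) (R : realType)
    (P : probability T R) (X : {RV P >-> nat}) (f : nat -> R) :
  (forall j, 0 <= f j) ->
  (\sum_(0 <= j <oo) (distribution P X [set j] * (f j)%:E) =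
   'E_P[(fun w => f (X w))])%E.
Proof.
move=> f0; rewrite [in RHS]unlock /=.
have XT : \bigcup_j (X @^-1` [set j]) = setT.
  by apply/seteqP; split => // w _; exists (X w).
have mX (B : set nat) : measurable (X @^-1` B).
  by rewrite -[_ @^-1` _]setTI; exact: measurable_funP.
rewrite -XT ge0_integral_bigcup//; last 3 first.
- rewrite XT => _ B _; rewrite setTI; exact: (mX [set j | B (f j)%:E]).
- by move=> w _; rewrite lee_fin.
- by apply/trivIsetP => i j _ _ ij; apply/seteqP; split => w //= [-> /eqP];
    rewrite (negbTE ij).
apply: eq_eseriesr => j _; rewrite muleC.
rewrite (eq_integral (cst (f j)%:E)).
  by rewrite integral_cst.
by move=> w; rewrite inE /= => ->.
Qed.

(** * Measurability of the events of the frog model *)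

Section Model.
Context {R : realType} {G : rooted_graph} {p : R} {mu : probability nat R}.
Variable M : frog_model G p mu.
Local Notation P := (fm_prob M).
Local Notation sleepers := (@sleepers R G p mu M).
Local Notation walk := (@walk R G p mu M).
Local Notation life := (@life R G p mu M).
Local Notation alive := (@alive R G p mu M).
Local Notation occupies := (@occupies R G p mu M).
Local Notation root_hit_at := (@root_hit_at R G p mu M).
Local Notation crossing_time := (@crossing_time R G p mu M).
Local Notation activation_time := (@activation_time R G p mu M).


Lemma measurable_sleepers x (B : set nat) :
  measurable [set w | B (sleepers x w)].
Proof. exact: (sleepers_rv M x B). Qed.

Lemma measurable_alive x i n : measurable [set w | alive x i n w].
Proof.
exact: (life_rv M x i
  [set o | is_true (if o is Some k then (n < k)%N else true)]).
Qed.

Definition follows x i n (y : nat -> G) (w : fm_space M) : Prop :=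
  forall k, (k <= n)%N -> walk x i k w = y k.

Lemma measurable_follows x i n y : measurable [set w | follows x i n y w].
Proof.
apply: measurable_forall => k; case: (boolP (k <= n)%N) => kn.
  rewrite (_ : mkset _ = [set w | walk x i k w = y k]).
    exact: (walk_rv M x i k (eq^~ (y k) : set _)).
  by apply/seteqP; split => w //=; apply.
by rewrite (_ : mkset _ = setT)//; apply/seteqP; split.
Qed.

Lemma measurable_occupies x i n y : measurable [set w | occupies x i n w y].
Proof.
rewrite (_ : mkset _ = [set w | (i < sleepers x w)%N] `&`
  ([set w | alive x i n w] `&` [set w | walk x i n w = y])).
  apply: measurableI; first exact: (measurable_sleepers x (fun j => (i < j)%N)).
  apply: measurableI; first exact: measurable_alive.
  exact: (walk_rv M x i n [set y]).
by apply/seteqP; split => w /=; [case|case=> ? []].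
Qed.

Lemma measurable_crossing_time x y :
  measurable_fun setT (crossing_time x y).
Proof.
(* An infimum over a random set of times becomes one over all [n], with the value +oo at times
   outside the set. *)
pose f n w := if `[< exists i, occupies x i n w y >] then (n%:R)%:E
              else +oo%E : \bar R.
have mf n : measurable_fun setT (f n).
  apply: measurable_fun_ifT => //.
  apply: (measurable_fun_bool true); rewrite setTI.
  rewrite (_ : _ @^-1` _ = [set w | exists i, occupies x i n w y]).
    by apply: measurable_exists => i; exact: measurable_occupies.
  by apply/seteqP; split => w /=; [move/asboolP|move=> ?; apply/asboolP].
apply: (eq_measurable_fun (fun w => ereal_inf [set f n w | n in setT])); last first.
  exact: measurable_ereal_inf.
move=> w _; rewrite /crossing_time; apply/eqP; rewrite eq_le.
apply/andP; split; apply: le_ereal_inf_tmp => _ /= [n hn <-].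
  by apply: ereal_inf_lbound; exists n => //; rewrite /f asboolT.
rewrite /f; case: asboolP => [h|_]; last exact: leey.
by apply: ereal_inf_lbound; exists n.
Qed.

(** Finite sequences of vertices form a countable type, so the infimum over paths is a countable
    one. *)
Lemma measurable_activation_time x :
  measurable_fun setT (activation_time x).
Proof.
apply: measurable_ereal_inf => s; apply: emeasurable_sum => e.
exact: measurable_crossing_time.
Qed.

Lemma measurable_root_hit_at m : measurable [set w | root_hit_at m w].
Proof.
apply: measurable_exists => x; apply: measurable_exists => i.
apply: measurable_exists => n; apply: measurableI (measurable_occupies _ _ _ _) _.
have mf : measurable_fun setT
    (fun w => activation_time x w + n%:R%:E)%E.
  by apply: emeasurable_funD; [exact: measurable_activation_time|].
by have := mf measurableT [set (m%:R : R)%:E] (emeasurable_set1 _); rewrite setTI.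
Qed.

(* A measure is unconstrained on non-measurable sets, so that covering
   [root_hit_io] by a null set does not suffice without this. *)
Lemma measurable_root_hit_io : measurable (root_hit_io M).
Proof.
rewrite (_ : root_hit_io M =
  [set w | forall n, exists m, (n <= m)%N /\ root_hit_at m w]).
  apply: measurable_forall => n; apply: measurable_exists => m.
  case: (boolP (n <= m)%N) => nm.
    rewrite (_ : mkset _ = [set w | root_hit_at m w]).
      exact: measurable_root_hit_at.
    by apply/seteqP; split => w //= [].
  by rewrite (_ : mkset _ = set0)//; apply/seteqP; split => w //= [].
apply/seteqP; split => w /=.
  by move=> /infinite_natP h n; have [m] := h n; exists m.
by move=> h; apply/infinite_natP => n; have [m []] := h n; exists m.
Qed.

(** * Survival probabilities and independence *)

(** Induction from the trivial bound 1: passing from n to n+1 removes the lifetime n+1, of mass (1 -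
    p) p^n, and p^n - (1 - p) p^n = p^(n+1). *)
Lemma alive_prob_le (p0 : 0 <= p) x i n :
  (P [set w | alive x i n w] <= (p ^+ n)%:E)%E.
Proof.
elim: n => [|n IH].
  by rewrite expr0; apply: probability_le1; exact: measurable_alive.
have split_alive : [set w | alive x i n w] =
    [set w | alive x i n.+1 w] `|` (life x i @^-1` [set Some n.+1]).
  apply/seteqP; split => w /=; rewrite /alive; case: (life x i w) => [k|].
  - by rewrite leq_eqVlt => /orP[/eqP <-|]; [right|left].
  - by left.
  - by case => [|[->]//]; exact: ltnW.
  - by [].
move: IH; rewrite split_alive measureU; last 3 first.
- exact: measurable_alive.
- exact: life_rv.
- apply/seteqP; split => w //= []; rewrite /alive => + wE; rewrite wE.
  by rewrite ltnn.
rewrite [X in (_ + X)%E](life_law M x i n) -leeBrDr// => alive_le.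
apply: (le_trans alive_le).
by rewrite -EFinB lee_fin exprS; lra.
Qed.

(** Brings finite trajectories within the scope of [fm_indep]: they are countable intersections of
    generators, padded with the full space after time [n]. *)
Lemma sigma_process_follows x i n y :
  sigma_process (walk x i) [set w | follows x i n y w].
Proof.
rewrite (_ : mkset _ =
  \bigcap_k (if (k <= n)%N then walk x i k @^-1` [set y k] else setT)); last first.
  apply/seteqP; split => w /= h k.
    by move=> _; case: ifP => // kn; exact: h.
  by move=> kn; have := h k I; rewrite kn.
case: (smallest_sigma_algebra [set: fm_space M]
  (\bigcup_m sigma_rv (walk x i m))) => s0 sC sU.
rewrite -[\bigcap_k _]setCK setC_bigcap -setTD; apply: (sC); apply: (sU) => k.
rewrite -setTD; apply: (sC); case: ifP => _.
  by apply: sub_sigma_algebra; exists k => //; exists [set y k].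
by have := sC _ s0; rewrite setD0.
Qed.

Lemma indep_event x i j n y :
  P ((sleepers x @^-1` [set j]) `&`
     ([set w | follows x i n y w] `&` [set w | alive x i n w])) =
  (mu [set j] * (P [set w | follows x i n y w] *
     P [set w | alive x i n w]))%E.
Proof.
pose A (e : G + G * nat + G * nat) : set (fm_space M) :=
  match e with
  | inl (inl _) => sleepers x @^-1` [set j]
  | inl (inr _) => [set w | follows x i n y w]
  | inr _ => [set w | alive x i n w]
  end.
have := @fm_indep _ _ _ _ M [:: inl (inl x); inl (inr (x, i)); inr (x, i)] A.
rewrite !big_cons !big_nil setIT mule1 /= sleepers_law; apply.
  by [].
move=> e; rewrite !inE => /or3P[] /eqP -> /=.
- by exists [set j].
- exact: sigma_process_follows.
- by exists [set o | is_true (if o is Some k then (n < k)%N else true)].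
Qed.
End Model.

Lemma srw_step_ge0 (R : realType) (G : rooted_graph) (x y : G) :
  0 <= srw_step R x y.
Proof. by rewrite divr_ge0. Qed.

(** * Walks ending at the root *)

(** Walks grow backwards from the root, by prepending a neighbour of the current starting point;
    those of length [n] have [n.+1] vertices. *)
Fixpoint walks_to_origin (G : rooted_graph) n : seq (seq G) :=
  if n is n'.+1 then
    [seq x :: s | s <- walks_to_origin G n', x <- nbrs (head (origin G) s)]
  else [:: [:: origin G]].

Lemma size_walks_to_origin (G : rooted_graph) d n :
  (forall x : G, degree x = d) -> size (walks_to_origin G n) = (d ^ n)%N.
Proof.
move=> deg_d; elim: n => //= n IH.
rewrite size_allpairs_dep (eq_map (g := fun=> d)); last first.
  by move=> s; exact: deg_d.
by rewrite sumnE big_map big_const_seq count_predT iter_addn_0 IH expnS.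
Qed.

Lemma mem_walks_to_origin (G : rooted_graph) n (y : nat -> G) :
  (forall k, (k < n)%N -> y k.+1 \in nbrs (y k)) -> y n = origin G ->
  mkseq y n.+1 \in walks_to_origin G n.
Proof.
elim: n y => [|n IH] y step yn; first by rewrite /= inE /mkseq /= yn.
have -> : mkseq y n.+2 = y 0%N :: mkseq (y \o succn) n.+1.
  by rewrite /mkseq /= (iotaDl 1 1) -map_comp.
apply/allpairsPdep; exists (mkseq (y \o succn) n.+1), (y 0%N).
split => //; first by apply: IH => // k kn; exact: step.
(* Prepending follows the edge from [y 1] to [y 0], against the direction of the walk. *)
by have /= := nbrs_sym (y 1%N) (y 0%N); rewrite step.
Qed.

(** * Probability that a walk is traversed, and Borel-Cantelli *)

Section Traversed.
Context {R : realType} {G : rooted_graph} {p : R} {mu : probability nat R}.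
Variable M : frog_model G p mu.
Local Notation P := (fm_prob M).

Lemma follows_prob_le d x i n (y : nat -> G) :
  (forall x : G, degree x = d) ->
  (P [set w | follows (M := M) x i n y w] <= ((d%:R^-1) ^+ n)%:E)%E.
Proof.
move=> deg_d; rewrite walk_law lee_fin.
apply: (@le_trans _ _ (1 * \prod_(k < n) d%:R^-1)).
  apply: ler_pM => //; first by apply: prodr_ge0 => k _; exact: srw_step_ge0.
    by case: (_ == _).
  apply: ler_prod => k _; rewrite srw_step_ge0/= /srw_step deg_d.
  by rewrite -[leRHS]mul1r ler_wpM2r ?invr_ge0//; case: (_ \in _).
by rewrite mul1r prodr_const card_ord.
Qed.

(** Activation is ignored: a particle that is never woken counts too. The event thus involves only
    the particles of the single site [y 0]. *)
Definition traversed n (y : nat -> G) (w : fm_space M) : Prop :=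
  exists2 i, (i < sleepers (y 0%N) w)%N &
    follows (M := M) (y 0%N) i n y w /\ alive (y 0%N) i n w.

Lemma measurable_traversed n y : measurable [set w | traversed n y w].
Proof.
rewrite (_ : mkset _ = [set w | exists i, (i < sleepers (y 0%N) w)%N /\
    (follows (M := M) (y 0%N) i n y w /\ alive (y 0%N) i n w)]).
  apply: measurable_exists => i.
  apply: (measurableI _ _ (measurable_sleepers M (y 0%N) (fun j => (i < j)%N))).
  exact: (measurableI _ _ (measurable_follows M _ _ _ _) (measurable_alive M _ _ _)).
by apply/seteqP; split => w /= [i]; [exists i|case; exists i].
Qed.

(** Split by the number j of particles at [y 0]: each part has probability at most mu{j} min(1, j q)
    <= mu{j} (j q)^eps, and q^eps factors out of the sum. *)
Lemma traversed_prob_le d r eps n (y : nat -> G) : 0 <= p <= r ->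
  (forall x : G, degree x = d) -> 0 < eps <= 1 ->
  (P [set w | traversed n y w] <=
   (((r / d%:R) ^+ n) `^ eps)%:E *
   \sum_(0 <= j <oo) (mu [set j] * (j%:R `^ eps)%:E))%E.
Proof.
(* [q] bounds the chance that one given particle follows the walk (d^-n) and stays alive (p^n <=
   r^n). *)
move=> /andP[p0 pr] deg_d eps01; set q := (r / d%:R) ^+ n.
have r0 : 0 <= r := le_trans p0 pr.
have q0 : 0 <= q by rewrite exprn_ge0// divr_ge0.
set x := y 0%N.
pose F i : set (fm_space M) :=
  [set w | follows (M := M) x i n y w] `&` [set w | alive x i n w].
have mF i : measurable (F i).
  exact: (measurableI _ _ (measurable_follows M _ _ _ _) (measurable_alive M _ _ _)).
pose E j : set (fm_space M) :=
  [set w | exists2 i, i \in iota 0 j & (sleepers x @^-1` [set j] `&` F i) w].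
have mS j : measurable (sleepers (f := M) x @^-1` [set j]).
  exact: (sleepers_rv M x).
have Emeas j : measurable (E j).
  rewrite (_ : E j = [set w | exists i, (i \in iota 0 j) /\
     (sleepers x @^-1` [set j] `&` F i) w]); last first.
    by apply/seteqP; split => w /= [i]; [exists i|case; exists i].
  apply: measurable_exists => i; case: (boolP (i \in iota 0 j)) => ij.
    rewrite (_ : mkset _ = sleepers x @^-1` [set j] `&` F i); first exact: measurableI.
    by apply/seteqP; split => w /=; [case|].
  by rewrite (_ : mkset _ = set0)//; apply/seteqP; split => w //= [].
have trE : [set w | traversed n y w] = \bigcup_j E j.
  apply/seteqP; split => w /=.
    move=> [i ix Fi]; exists (sleepers x w) => //; exists i => //.
    by rewrite mem_iota.
  move=> [j _ [i]]; rewrite mem_iota /= => ij [sj Fi]; exists i => //.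
  by rewrite sj.
have Fq i j : (P (sleepers x @^-1` [set j] `&` F i) <= mu [set j] * q%:E)%E.
  rewrite /F indep_event; apply: lee_wpmul2l => //.
  apply: (@le_trans _ _ ((d%:R^-1 ^+ n)%:E * (r ^+ n)%:E)%E).
    apply: lee_pmul => //; first exact: follows_prob_le.
    apply: le_trans (alive_prob_le _ p0 _ _ _) _.
    by rewrite lee_fin lerXn2r.
  by rewrite -EFinM /q expr_div_n exprVn mulrC.
have Ele j : (P (E j) <= mu [set j] * ((j%:R * q) `^ eps)%:E)%E.
  have jq0 : 0 <= j%:R * q by rewrite mulr_ge0.
  have := min_le_powR jq0 eps01 => le_min.
  apply: (@le_trans _ _ (mu [set j] * (Num.min 1 (j%:R * q))%:E)%E); last first.
    by apply: lee_wpmul2l => //; rewrite lee_fin.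
  (* The bound 1 comes from the inclusion of [E j] in the event of having j sleepers, the bound j q
     from a union bound over the j particles. *)
  rewrite minEle; case: ifP => _.
    rewrite mule1 -(sleepers_law M x); apply: le_measure; rewrite ?inE//.
    by move=> w [i _ []].
  rewrite EFinM muleCA.
  have := @measure_exists_le _ _ _ P _ (iota 0 j)
    (fun i => sleepers x @^-1` [set j] `&` F i) _
    (fun i => measurableI _ _ (mS j) (mF i)) (Fq^~ j).
  by rewrite size_iota.
rewrite trE; apply: le_trans (generalized_Boole_inequality _ _ _) _ => //.
  exact: bigcupT_measurable.
rewrite -nneseriesZl; last by move=> j _; rewrite mule_ge0// lee_fin powR_ge0.
apply: lee_nneseries => // j _.
by rewrite muleCA -EFinM -powRM// (mulrC q); exact: Ele.
Qed.

(** The law of a walk fixes its start and its nearest-neighbour steps only almost surely. Indexing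
    by finite sequences rather than by functions keeps the exceptional union countable. *)
Definition bad_walk w : Prop := exists e : G * nat * seq G,
  ~ (nth (origin G) e.2 0 = e.1.1 /\ forall k, (k < (size e.2).-1)%N ->
     nth (origin G) e.2 k.+1 \in nbrs (nth (origin G) e.2 k)) /\
  follows (M := M) e.1.1 e.1.2 (size e.2).-1 (nth (origin G) e.2) w.

Lemma negligible_bad_walk : P.-negligible [set w | bad_walk w].
Proof.
apply: negligible_exists => -[[x i] s] /=; set n := (size s).-1.
set y := nth (origin G) s.
case: (pselect (y 0%N = x /\ forall k, (k < n)%N -> y k.+1 \in nbrs (y k))).
  move=> good; apply: (@negligibleS _ _ _ _ set0); last exact: negligible_set0.
  by move=> w /= [].
move=> bad; apply: (@negligibleS _ _ _ _ [set w | follows (M := M) x i n y w]).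
  by move=> w /= [].
apply/negligibleP; first exact: measurable_follows.
apply: etrans (walk_law M x i n y) _.
(* The law of the trajectory has a zero factor: the indicator of the start, or a step to a
   non-neighbour. *)
have [y0|] := eqVneq (y 0%N) x; last by rewrite mul0r.
have [k kn yk] : exists2 k, (k < n)%N & y k.+1 \notin nbrs (y k).
  apply: contrapT => h; apply: bad; split => // k kn.
  by apply: contrapT => /negP yk; apply: h; exists k.
rewrite mul1r (bigD1 (Ordinal kn))//= {1}/srw_step (negbTE yk) mul0r.
by rewrite mul0r.
Qed.

(** By contraposition: the first [n.+1] positions of an offending walk witness [bad_walk]. *)
Lemma good_walkE w x i n : ~ bad_walk w ->
  walk x i 0%N w = x /\
  forall k, (k < n)%N -> walk x i k.+1 w \in nbrs (walk x i k w).
Proof.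
move=> good; apply: contrapT => bad; apply: good.
have [s sE] : exists s, s = mkseq (walk x i ^~ w) n.+1 by eexists.
have szs : size s = n.+1 by rewrite sE size_mkseq.
have nths k : (k <= n)%N -> nth (origin G) s k = walk x i k w.
  by move=> kn; rewrite sE nth_mkseq.
exists (x, i, s) => /=; rewrite szs /=; split; last by move=> k /nths.
move=> [h0 h]; apply: bad; split; first by rewrite -nths.
by move=> k kn; rewrite -!nths ?h// ltnW.
Qed.

Definition traversed_at n w : Prop :=
  exists2 s, s \in walks_to_origin G n & traversed n (nth (origin G) s) w.

Lemma measurable_traversed_at n : measurable [set w | traversed_at n w].
Proof.
rewrite (_ : mkset _ = [set w | exists s, s \in walks_to_origin G n /\
  traversed n (nth (origin G) s) w]); last first.
  by apply/seteqP; split => w /= [s]; [exists s|case; exists s].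
apply: measurable_exists => s; case: (boolP (s \in walks_to_origin G n)) => sn.
  rewrite (_ : mkset _ = [set w | traversed n (nth (origin G) s) w]).
    exact: measurable_traversed.
  by apply/seteqP; split => w //= [].
by rewrite (_ : mkset _ = set0)//; apply/seteqP; split => w //= [].
Qed.

(** Off both events the lengths of traversed walks to the root are bounded, so visits arise from
    finitely many pairs (starting site, length), each of which determines one time. *)
Lemma root_hit_io_sub :
  root_hit_io M `<=`
  [set w | bad_walk w] `|` lim_sup_set (fun n => [set w | traversed_at n w]).
Proof.
move=> w /= hit; case: (pselect (bad_walk w)) => [|good]; [by left|right].
apply: contrapT => nlim; apply: hit.
have [N NP] : exists N, forall n, (N <= n)%N -> ~ traversed_at n w.
  apply: contrapT => h; apply: nlim => N _; apply: contrapT => nN; apply: h.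
  by exists N => n Nn tn; apply: nN; exists n.
(* At a visit the sum is a natural number, so [fine] and [Num.truncn] recover it exactly. *)
pose g (e : G * nat) :=
  Num.truncn (fine (activation_time (M := M) e.1 w + e.2%:R%:E)%E).
pose L := [seq (head (origin G) s, n) | n <- iota 0 N, s <- walks_to_origin G n].
apply: (@sub_finite_set _ _ [set` map g L]); last exact: finite_seq.
move=> m /= [x [i [n [[ix ai wn] Tm]]]].
apply/mapP; exists (x, n); last by rewrite /g /= Tm /= natrK.
have [w0 step] := good_walkE x i n good.
have yn := mem_walks_to_origin step wn.
apply/allpairsPdep; exists n, (mkseq (walk x i ^~ w) n.+1).
split => //=; last by rewrite w0.
(* Were the length at least [N], the particle's own trajectory would be a traversed walk forbidden
   by [N]. *)
rewrite mem_iota /= ltnNge; apply/negP => /NP; apply.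
exists (mkseq (walk x i ^~ w) n.+1) => //; exists i; first by rewrite /= w0.
by rewrite /= w0; split => // k kn; rewrite nth_mkseq.
Qed.

Lemma root_hit_io_prob0 d r eps : 0 <= p <= r -> 0 < r -> (0 < d)%N ->
  (forall x : G, degree x = d) -> 0 < eps <= 1 ->
  d%:R * (r / d%:R) `^ eps < 1 ->
  (\sum_(0 <= j <oo) (mu [set j] * (j%:R `^ eps)%:E) < +oo)%E ->
  P (root_hit_io M) = 0%E.
Proof.
move=> pr r0 d0 deg_d eps01; set rho := _ * _ => rho1; set K := (X in (X < _)%E) => Koo.
have K0 : (0 <= K)%E.
  by apply: nneseries_ge0 => j _ _; rewrite mule_ge0// lee_fin powR_ge0.
have rho0 : 0 < rho by rewrite mulr_gt0 ?powR_gt0 ?divr_gt0 ?ltr0n.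
apply/negligibleP; first exact: measurable_root_hit_io.
apply: negligibleS root_hit_io_sub _; apply: negligibleU.
  exact: negligible_bad_walk.
have mB n := measurable_traversed_at n.
apply/negligibleP; first by apply: bigcap_measurable => // n _; exact: bigcup_measurable.
(* Borel-Cantelli: it remains to sum the probabilities, dominated by K rho^n. *)
apply: lim_sup_set_cvg0 => //.
apply: (@le_lt_trans _ _ (\sum_(0 <= n <oo) (fine K)%:E * (rho ^+ n)%:E)%E).
  apply: lee_nneseries => // n _.
  rewrite fineK ?ge0_fin_numE//.
  apply: le_trans (@measure_exists_le _ _ _ P _ (walks_to_origin G n)
    (fun s => traversed n (nth (origin G) s)) _
    (fun s => measurable_traversed n _)
    (fun s => traversed_prob_le n (nth (origin G) s) pr deg_d eps01)) _.
  rewrite (size_walks_to_origin _ deg_d) muleA -EFinM muleC lee_wpmul2l// lee_fin.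
  have q0 : 0 <= r / d%:R by rewrite divr_ge0// ltW.
  (* Swapping exponents, ((r/d)^n)^eps = ((r/d)^eps)^n, so the d^n walks contribute the factor
     rho^n. *)
  rewrite natrX -(powR_mulrn _ q0) -powRrM (mulrC n%:R) powRrM.
  by rewrite (powR_mulrn _ (powR_ge0 _ _)) -exprMn.
rewrite nneseriesZl; last by move=> n _; rewrite lee_fin exprn_ge0// ltW.
rewrite lte_mul_pinfty ?lee_fin ?fine_ge0//.
by apply: geometric_nneseries_lty; rewrite rho0.
Qed.
End Traversed.

(** * Choice of the exponent, and conclusion *)

(** With A = -ln p and B = ln b, taking logarithms reduces the claim to B < eps (A + B); eps = 2B /
    (A + 2B) works because A + 2B < 2(A + B). *)
Lemma exists_exponent (R : realType) (p b : R) : 0 < p < 1 -> 1 < b ->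
  exists2 eps, 0 < eps < 1 & b * (p / b) `^ eps < 1.
Proof.
move=> /andP[p0 p1] b1; have b0 : 0 < b by apply: lt_trans b1.
have lb : 0 < ln b by rewrite ln_gt0.
have lp : ln p < 0 by rewrite ln_lt0// p0.
set B := ln b in lb *; pose A := - ln p.
have A0 : 0 < A by rewrite oppr_gt0.
have AB : 0 < A + 2 * B by lra.
exists (2 * B / (A + 2 * B)).
  by rewrite divr_gt0 ?ltr_pdivrMr//=; lra.
rewrite -[p / b]lnK ?posrE ?divr_gt0// -[X in X * _](lnK b0) -/B.
rewrite -expRM -expRD -[ltRHS]expR0 ltr_expR.
rewrite ln_div ?posrE// -/B -[ln p]opprK -/A.
have -> : B + (- A - B) * (2 * B / (A + 2 * B)) = - (A * B / (A + 2 * B)).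
  by field; rewrite gt_eqF.
by rewrite oppr_lt0 divr_gt0// mulr_gt0.
Qed.

Theorem theorem1p9 (R : realType) (d : nat) (hd : (3 <= d)%N)
  (Td : rooted_graph) (hTd : homogeneous_tree d Td)
  (disp : measure_display) (Omega : measurableType disp)
  (P : probability Omega R) (eta : {RV P >-> nat})
  (heta : (0 < P [set w | (1 <= eta w)%N])%E)
  (hmom : forall eps : R, 0 < eps < 1 ->
     ('E_P[(fun w => ((eta w)%:R `^ eps)%R)] < +oo)%E) :
  p_u Td (distribution P eta) = 1.
Proof.
have only1 : recurrent_params Td (distribution P eta) `<=` [set 1].
  move=> p [/andP[p0 p1] [M hit_gt0]] /=; apply/eqP; rewrite eq_le p1 leNgt /=.
  (* Passing from p to a larger r < 1 avoids the degenerate case p = 0. *)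
  apply/negP => plt1; pose r := (p + 1) / 2.
  have r01 : 0 < r < 1 by rewrite /r; apply/andP; split; lra.
  have pr : 0 <= p <= r by rewrite p0 /r; lra.
  have d1 : (1 : R) < d%:R by rewrite ltr1n (leq_trans _ hd).
  have [eps eps01 rho1] := exists_exponent r01 d1.
  have /andP[eps0 eps1] := eps01; have /andP[r0 _] := r01.
  have hit0 : fm_prob M (root_hit_io M) = 0%E.
    apply: (@root_hit_io_prob0 _ _ _ _ M d r eps) => //.
    - by rewrite (leq_trans _ hd).
    - exact: hTd.1.
    - by rewrite eps0 ltW.
    - by rewrite moment_nneseries ?hmom// => j; exact: powR_ge0.
  by rewrite hit0 ltxx in hit_gt0.
(* If no parameter is recurrent, the convention gives 1; otherwise a nonempty subset of {1} is {1}
   itself. *)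
rewrite /p_u; case: asboolP => // -[p p_rec].
rewrite (_ : recurrent_params _ _ = [set 1]) ?inf1//.
by apply/seteqP; split => // _ /= ->; rewrite -(only1 _ p_rec).
Qed.
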